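(* Let $\mathbf{P}\in\mathbb{R}^{N\times N}$ be a diagonal matrix with positive diagonal entries and let $\mathbf{U}\in\mathbb{R}^{N\times s}$ ($N>s$) have orthonormal columns. Let $\mathbf{P}^{1/2}\mathbf{U}=\mathbf{U}_y\boldsymbol{\Sigma}_y\mathbf{V}_y^\top$ be a thin SVD. Fix $\beta\in(0,1]$ such that $\xi_i(\mathbf{U})\ge\beta\,\xi_i(\mathbf{U}_y)$ for all $i\in\{1,\dots,N\}$. Let $c,\nu$ be positive integers and set $\eta_i=\min\{1,c\,\xi_i(\mathbf{U})\}$, assumed positive for all $i$. For $t=1,\dots,\nu$ and $i=1,\dots,N$ let $\gamma_i^{(t)}$ be independent Bernoulli random variables with $\mathbb{P}(\gamma_i^{(t)}=1)=\eta_i$, let $\mathbf{S}_t$ be the $N\times N$ diagonal matrix with diagonal entries $\gamma_i^{(t)}/\sqrt{\eta_i}$, and let $$\bar{\mathbf{Y}}(\mathbf{P})=\frac1\nu\sum_{t=1}^\nu\mathbf{U}^\top\mathbf{P}^{1/2}\mathbf{S}_t^\top\mathbf{S}_t\mathbf{P}^{1/2}\mathbf{U}.$$ Then $$\mathbb{P}\bigl(\bar{\mathbf{Y}}(\mathbf{P})\not\succ0\bigr)\le2s\exp\left(-\frac{3\nu c\beta}{8s}\right).$$ In particular, for $0<\delta^\star<1$, $\mathbb{P}\bigl(\bar{\mathbf{Y}}(\mathbf{P})\succ0\bigr)\ge1-\delta^\star$ whenever $$c\ge\frac{8s}{3\nu\beta}\log\frac{2s}{\delta^\star}.$$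
   Context: For a real $N\times s$ matrix $\mathbf{A}$ of rank $s$, with thin SVD $\mathbf{A}=\mathbf{U}_{\mathbf{A}}\boldsymbol{\Sigma}_{\mathbf{A}}\mathbf{V}_{\mathbf{A}}^\top$, the leverage score of its $i$-th row is $\ell_i(\mathbf{A})=\mathbf{a}_{(i)}(\mathbf{A}^\top\mathbf{A})^{-1}\mathbf{a}_{(i)}^\top=\|(\mathbf{u}_{\mathbf{A}})_{(i)}\|^2$, where $\mathbf{a}_{(i)}$ denotes the $i$-th row of $\mathbf{A}$; and $\xi_i(\mathbf{A})=s^{-1}\ell_i(\mathbf{A})$. $\mathbf{A}\succ0$ means symmetric positive definite. *)

(* Defs.v *)
From HB Require Import structures.
From mathcomp Require Import all_boot all_order all_algebra.
From mathcomp Require Import all_classical all_reals all_analysis.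

Set Implicit Arguments.
Unset Strict Implicit.
Unset Printing Implicit Defensive.

Import Order.TTheory GRing.Theory Num.Theory.

Local Open Scope classical_set_scope.
Local Open Scope ring_scope.

Definition orthonormal_cols (R : realType) (m n : nat) (A : 'M[R]_(m, n)) :
  Prop := A^T *m A = 1%:M.

Definition posdefmx (R : realType) (n : nat) (A : 'M[R]_n) : Prop :=
  A^T = A /\ forall v : 'cV[R]_n, v != 0 -> 0 < (v^T *m A *m v) 0 0.

(* The singular values (the diagonal of S) are not required to be sorted. *)
Definition thin_svd (R : realType) (N s : nat) (A : 'M[R]_(N, s))
    (U : 'M[R]_(N, s)) (S V : 'M[R]_s) : Prop :=
  [/\ orthonormal_cols U,
      is_diag_mx S, forall j, 0 <= S j j,
      orthonormal_cols V
    & A = U *m S *m V^T].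

(* Meaningful when A has rank s: otherwise A^T *m A is not invertible and
   invmx leaves it unchanged. *)
Definition leverage (R : realType) (N s : nat) (A : 'M[R]_(N, s)) (i : 'I_N) :
  R := (row i A *m invmx (A^T *m A) *m (row i A)^T) 0 0.

Definition xi (R : realType) (N s : nat) (A : 'M[R]_(N, s)) (i : 'I_N) : R :=
  s%:R^-1 * leverage A i.

Definition row_prob (R : realType) (N s : nat) (c : nat) (U : 'M[R]_(N, s))
    (i : 'I_N) : R := Num.min 1 (c%:R * xi U i).

(* P^{1/2} for a diagonal matrix P with nonnegative entries. *)
Definition sqrt_diag (R : realType) (N : nat) (P : 'M[R]_N) : 'M[R]_N :=
  diag_mx (\row_i Num.sqrt (P i i)).

(* The Bernoulli outcome g i : bool is cast to 0 or 1 in R. *)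
Definition sketch_mx (R : realType) (N : nat) (p : 'I_N -> R)
    (g : 'I_N -> bool) : 'M[R]_N :=
  diag_mx (\row_i ((g i)%:R / Num.sqrt (p i))).

Definition Ybar (R : realType) (N s nu : nat) (P : 'M[R]_N)
    (U : 'M[R]_(N, s)) (p : 'I_N -> R) (g : 'I_nu -> 'I_N -> bool) :
  'M[R]_s :=
  nu%:R^-1 *: \sum_(t < nu)
    (U^T *m sqrt_diag P *m (sketch_mx p (g t))^T
       *m sketch_mx p (g t) *m sqrt_diag P *m U).

Definition mutually_independent (d d' : measure_display)
    (Om : measurableType d) (T : measurableType d') (R : realType)
    (Pr : probability Om R) (I : finType) (X : I -> {RV Pr >-> T}) : Prop :=
  forall (J : {set I}) (B : I -> set T), (forall i, measurable (B i)) ->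
    Pr (\bigcap_(i in [set` J]) (X i @^-1` B i)) =
      (\prod_(i in J) Pr (X i @^-1` B i))%E.

(* Main.v *)
(* The matrix Y is singular exactly when the rows u_i of U selected in some
   round fail to span, whatever the positive weights are, so P(Y not > 0) is at
   most the expected corank of the selected rows.  Write l_i = |u_i|^2 and let
   the nu copies of row i arrive independently at rate l_i, up to time c / s; a
   copy has then arrived with probability 1 - exp(- c l_i / s) <= eta_i, so this
   process selects less.  The trace of the orthogonal projector onto the
   orthocomplement of the span of the rows already selected is their corank, and
   only rows outside the span contribute to it: hence the expected corank D
   satisfies D' <= - nu D, and D <= s exp(- nu c / s) at time c / s.  This beats
   the claimed bound because beta <= 1. *)
Require Import Defs.
From HB Require Import structures.
From mathcomp Require Import all_boot all_order all_algebra.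
From mathcomp Require Import all_classical all_reals all_analysis.
From mathcomp Require Import ring lra.

Set Implicit Arguments.
Unset Strict Implicit.
Unset Printing Implicit Defensive.

Import Order.TTheory GRing.Theory Num.Theory.
Import numFieldNormedType.Exports.

Local Open Scope classical_set_scope.
Local Open Scope ring_scope.

Lemma is_derive_mulr (R : realType) (k x : R) :
  is_derive x 1 (fun a => k * a) k.
Proof.
by have := is_deriveZ k (is_derive_id x (1 : R)); rewrite /GRing.scale /= mulr1.
Qed.

(** * Random unions of independently included elements, and their evolution in time *)

Section RandomUnion.
Variables (R : realType) (I : finType).
Implicit Types (q l : I -> R) (f g : {set I} -> R) (S B : {set I}).

(* [runion q r f S] is the expectation of [f (S :|: A)], where the random set
   [A] contains each [i] of [r] independently with probability [1 - q i]. *)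
Fixpoint runion q (r : seq I) f S : R :=
  if r is i :: r' then
    q i * runion q r' f S + (1 - q i) * runion q r' f (i |: S)
  else f S.

Lemma runion_linear q r (a b : R) f g S :
  runion q r (fun S => a * f S + b * g S) S =
  a * runion q r f S + b * runion q r g S.
Proof. by elim: r S => [|i r IH] S //=; rewrite !IH; ring. Qed.

Lemma runion_le q r f g S : (forall i, 0 <= q i <= 1) ->
  (forall S, f S <= g S) -> runion q r f S <= runion q r g S.
Proof.
move=> q01 fg; elim: r S => [|i r IH] S //=.
have /andP[q0 q1] := q01 i.
by apply: lerD; apply: ler_wpM2l; rewrite ?subr_ge0.
Qed.

Lemma runion_setU1 q r f j S :
  runion q r f (j |: S) = runion q r (fun S => f (j |: S)) S.
Proof. by elim: r S => [|i r IH] S //=; rewrite finset.setUCA !IH. Qed.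

(** Each draw averages the values without and with [i]. The value without [i] is the larger one, so
    a larger omission probability can only raise the average. *)
Lemma runion_antitone q q' r f S : (forall i, 0 <= q i <= 1) ->
  (forall i, q i <= q' i) -> (forall i, q' i <= 1) ->
  (forall i S, f (i |: S) <= f S) -> runion q r f S <= runion q' r f S.
Proof.
move=> q01 qq' q'1 fanti; elim: r S => [|i r IH] S //=.
have /andP[q0 q1] := q01 i.
have : runion q' r f (i |: S) <= runion q' r f S.
  rewrite runion_setU1; apply: runion_le => [j|S' //].
  by have /andP[/le_trans-> // _] := q01 j; rewrite q'1.
have := IH (i |: S); have := IH S; have := qq' i; have := q'1 i.
set a := runion q r f S; set b := runion q r f (i |: S).
set a' := runion q' r f S; set b' := runion q' r f (i |: S).
move=> q'i1 qq'i aa' bb' b'a'.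
(* First change the two values at fixed weight [q i], then move weight from [b'] to the larger
   [a']. *)
apply: (@le_trans _ _ (q i * a' + (1 - q i) * b')); last by nra.
by apply: lerD; apply: ler_wpM2l; rewrite ?subr_ge0.
Qed.

Lemma runion_prod q r (phi : I -> bool -> R) S : uniq r ->
  runion q r (fun S => \prod_i phi i (i \in S)) S =
  \prod_i (if i \in r then q i * phi i (i \in S) + (1 - q i) * phi i true
           else phi i (i \in S)).
Proof.
elim: r S => [|i r IH] S //= /andP[ir ur].
rewrite !IH // (bigD1 i) //= [X in _ + _ * X](bigD1 i) //=.
rewrite [RHS](bigD1 i) //= (negPf ir) in_cons eqxx !inE eqxx /=.
rewrite mulrA [_ * (phi i true * _)]mulrA.
have eqP1 : \prod_(j | j != i) (if j \in r
      then q j * phi j (j \in i |: S) + (1 - q j) * phi j true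
      else phi j (j \in i |: S)) =
    \prod_(j | j != i) (if j \in r
      then q j * phi j (j \in S) + (1 - q j) * phi j true
      else phi j (j \in S)).
  by apply: eq_bigr => j ji; rewrite !inE (negPf ji).
rewrite eqP1 -mulrDl; congr (_ * _).
by apply: eq_bigr => j ji; rewrite in_cons (negPf ji).
Qed.

Lemma runion_pmf q f : runion q (enum I) f finset.set0 =
  \sum_(B : {set I}) f B * \prod_i (if i \in B then 1 - q i else q i).
Proof.
have runionE r S : runion q r f S =
    \sum_(B : {set I}) f B * runion q r (fun S => (S == B)%:R) S.
  elim: r S => [|i r IH] S /=.
    rewrite (bigD1 S) //= eqxx mulr1 big1 ?addr0 // => B BS.
    by rewrite eq_sym (negPf BS) mulr0.
  rewrite !IH !mulr_sumr -big_split /=; apply: eq_bigr => B _; ring.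
rewrite runionE; apply: eq_bigr => B _; congr (_ * _).
(* The indicator of a single set is a product over coordinates, so its expectation factors by
   [runion_prod]. *)
have -> : (fun S => (S == B)%:R) =
    (fun S => \prod_i ((i \in S) == (i \in B))%:R) :> ({set I} -> R).
  apply/funext => S; case: eqP => [->|/eqP SB].
    by rewrite big1 // => i _; rewrite eqxx.
  have [i iSB|/= SBE] := pickP (fun i => (i \in S) != (i \in B)).
    by rewrite (bigD1 i) //= (negPf iSB) mul0r.
  by case/eqP: SB; apply/setP => i; apply/eqP; have /negbFE := SBE i.
rewrite (@runion_prod q _ (fun i b => (b == (i \in B))%:R)) ?enum_uniq //.
apply: eq_bigr => i _; rewrite mem_enum !inE /=.
by case: (i \in B) => /=; ring.
Qed.

(** Kolmogorov's forward equation: when [i] arrives at rate [l i], it is still absent at time [a]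
    with probability [expR (- l i * a)], and the derivative of the expectation of [f] is the
    expectation of the generator applied to [f]. *)
Lemma is_derive_runion l r f S (a : R) :
  is_derive a 1 (fun a => runion (fun i => expR (- l i * a)) r f S)
    (runion (fun i => expR (- l i * a)) r
       (fun S => \sum_(i <- r) l i * (f (i |: S) - f S)) S).
Proof.
elim: r f S => [|i r IH] f S /=.
  by rewrite big_nil; exact: is_derive_cst.
pose q i := expR (- l i * a).
have dq : is_derive a 1 (fun a => expR (- l i * a)) (- l i * q i).
  have := is_derive1_comp (is_derive_expR _) (is_derive_mulr (- l i) a).
  by rewrite mulrC.
have d0 := is_deriveM dq (IH f S).
have d1 := is_deriveM (is_deriveB (is_derive_cst (1 : R) a 1) dq)
  (IH f (i |: S)).
refine (is_derive_eq (is_deriveD d0 d1) _).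
have gen S' :
    runion q r (fun S => \sum_(j <- i :: r) l j * (f (j |: S) - f S)) S' =
      l i * (runion q r f (i |: S') - runion q r f S') +
      runion q r (fun S => \sum_(j <- r) l j * (f (j |: S) - f S)) S'.
  rewrite runion_setU1 -[RHS]mulr1 [RHS]mulrC mulrDr mulrBr -mulNr.
  rewrite -!runion_linear; congr runion; apply/funext => T.
  by rewrite big_cons; ring.
(* Once [i] is present its generator term vanishes, as adding [i] again changes nothing. Only the
   branch without [i], of weight [q i], keeps that term, which matches the derivative of [q i]. *)
rewrite !gen finset.setUA finset.setUid /GRing.scale /= -/q -/(q i).
rewrite (_ : (cst 1 - _) a = 1 - q i) //; ring.
Qed.

(** A Gronwall argument: the hypothesis makes the generator at most [- nu * f] pointwise, so
    [expR (nu * a)] times the expectation is nonincreasing in [a]. *)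
Lemma runion_decay l (nu a : R) f S : 0 <= a -> (forall i, 0 <= l i) ->
  (forall S, nu * f S <= \sum_i l i * (f S - f (i |: S))) ->
  runion (fun i => expR (- l i * a)) (enum I) f S <= expR (- nu * a) * f S.
Proof.
move=> a0 l0 nuf; pose q (a : R) i := expR (- l i * a).
pose h (a : R) := expR (nu * a) * runion (q a) (enum I) f S.
pose L S := \sum_(i <- enum I) l i * (f (i |: S) - f S).
have dh (x : R) : is_derive x 1 h
    (expR (nu * x) * runion (q x) (enum I) (fun S => nu * f S + 1 * L S) S).
  have de := is_derive1_comp (is_derive_expR _) (is_derive_mulr nu x).
  refine (is_derive_eq (is_deriveM de (is_derive_runion l (enum I) f S x)) _).
  rewrite runion_linear /GRing.scale /=; ring.
have h_le : h a <= h 0.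
  apply: (@ler0_derive1_nincr _ h 0 a) => // [x /itvP x0|].
  - rewrite derive1E; have -> := @derive_val _ _ _ _ _ _ _ (dh x).
    rewrite -[leRHS](mulr0 (expR (nu * x))) ler_wpM2l ?expR_ge0 //.
    rewrite -[leRHS](_ : runion (q x) (enum I) (fun=> 0) S = 0); last first.
      by elim: (enum I) (S) => //= i r IH S'; rewrite !IH; ring.
    apply: runion_le => [i|S'].
      rewrite expR_ge0 -[leRHS]expR0 ler_expR mulNr oppr_le0.
      by rewrite mulr_ge0 // x0.
    rewrite mul1r; have := nuf S'; rewrite -subr_le0; apply: le_trans.
    rewrite /L big_enum /= lerD2l -sumrN ler_sum // => i _.
    by rewrite -mulrN opprB.
  - apply: continuous_subspaceT => x.
    by apply: differentiable_continuous; apply/derivable1_diffP; case: (dh x).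
(* At time 0 nothing has arrived. *)
have q0 : runion (q 0) (enum I) f S = f S.
  elim: (enum I) (S) => //= i r IH S'.
  by rewrite !IH /q mulr0 expR0 subrr mul1r mul0r addr0.
move: h_le; rewrite /h q0 mulr0 expR0 mul1r => h_le.
by rewrite mulNr expRN -ler_pdivrMl ?invr_gt0 ?expR_gt0 // invrK.
Qed.

End RandomUnion.

(** * Gram matrices, orthogonal projectors and rank *)

Lemma gram_ge0 (R : realType) (n : nat) (v : 'rV[R]_n) : 0 <= (v *m v^T) 0 0.
Proof. by rewrite mxE sumr_ge0 // => j _; rewrite mxE -expr2 sqr_ge0. Qed.

Lemma gram_eq0 (R : realType) (n : nat) (v : 'rV[R]_n) :
  v *m v^T = 0 -> v = 0.
Proof.
move=> /matrixP/(_ 0 0); rewrite !mxE => /eqP; rewrite psumr_eq0; last first.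
  by move=> j _; rewrite mxE -expr2 sqr_ge0.
move=> /allP v0; apply/rowP => j; have := v0 j (mem_index_enum _).
by rewrite !mxE -expr2 sqrf_eq0 => /eqP.
Qed.

Lemma unitmx_gram (R : realType) (m n : nat) (C : 'M[R]_(m, n)) :
  row_free C -> C *m C^T \in unitmx.
Proof.
move=> Cfree; rewrite -row_free_unit; apply: inj_row_free => v vCC.
apply/eqP; rewrite -(mulmx_free_eq0 v Cfree); apply/eqP/gram_eq0.
by rewrite trmx_mul mulmxA -[v *m C *m _]mulmxA vCC mul0mx.
Qed.

(* The trace of the orthogonal projector onto the orthocomplement of the row
   space of [A] is the corank of [A]; rows of [U] in that row space do not
   contribute to it. *)
Lemma corank_le_leverage (R : realType) (N s m : nat) (U : 'M[R]_(N, s))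
    (A : 'M[R]_(m, s)) : orthonormal_cols U ->
  s%:R - (\rank A)%:R <=
  \sum_i (row i U *m (row i U)^T) 0 0 * (~~ (row i U <= A)%MS)%:R.
Proof.
move=> Uorth.
(* The rows of [C] form a basis of the orthocomplement of the row space of [A]; [Q] below is the
   orthogonal projector onto it. *)
have [d [C [Cfree CA dE]]] : exists d (C : 'M[R]_(d, s)),
    [/\ row_free C, C *m A^T = 0 & d%:R = s%:R - (\rank A)%:R :> R].
  exists _, (row_base (kermx A^T)); split; first by rewrite row_base_free.
    by apply/sub_kermxP; rewrite eq_row_base.
  by rewrite mxrank_ker mxrank_tr natrB // rank_leq_col.
pose G := invmx (C *m C^T); pose Q := C^T *m G *m C.
have CCu := unitmx_gram Cfree.
have trQ : \tr Q = s%:R - (\rank A)%:R.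
  by rewrite /Q mxtrace_mulC mulmxA mulmxV // mxtrace1 dE.
have QT : Q^T = Q.
  by rewrite /Q !trmx_mul trmxK /G trmx_inv trmx_mul trmxK mulmxA.
have QQ : Q *m Q = Q.
  rewrite /Q !mulmxA; congr (_ *m C).
  by rewrite -[C^T *m G *m C *m _]mulmxA -[C^T *m G *m _ *m G]mulmxA
             mulmxV ?mulmx1.
(* Insert [U^T *m U = 1] into the trace of [Q] and move [U] around cyclically. *)
have -> : s%:R - (\rank A)%:R = \sum_i (row i U *m Q *m (row i U)^T) 0 0.
  rewrite -trQ -[Q in LHS]mulmx1 -Uorth mulmxA mxtrace_mulC mulmxA /mxtrace.
  apply: eq_bigr => i _; rewrite -row_mul !mxE; apply: eq_bigr => j _.
  by rewrite !mxE.
apply: ler_sum => i _; set u := row i U.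
have [/submxP[w uw]|_] /= := boolP (u <= A)%MS.
  have -> : u *m Q = 0.
    rewrite /Q uw !mulmxA -[w *m A *m C^T]mulmxA.
    by rewrite -[A *m C^T]trmxK trmx_mul trmxK CA trmx0 mulmx0 !mul0mx.
  by rewrite mul0mx mulr0 mxE.
(* By Pythagoras, the squared norm of [u - u *m Q] is that of [u] minus [u *m Q *m u^T]. *)
rewrite mulr1; have := gram_ge0 (u - u *m Q).
rewrite linearB /= mulmxBl !mulmxBr trmx_mul QT.
rewrite [u *m Q *m (Q *m _)]mulmxA -[u *m Q *m Q]mulmxA QQ
        [u *m (Q *m _)]mulmxA.
by rewrite subrr subr0 !mxE subr_ge0.
Qed.

Lemma rank_adds_row (F : fieldType) (n m : nat) (u : 'rV[F]_n)
    (A : 'M[F]_(m, n)) :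
  \rank (u + A)%MS = (\rank A + ~~ (u <= A)%MS)%N.
Proof.
have [uA|uA] /= := boolP (u <= A)%MS.
  by rewrite addn0 (addsmx_idPr uA).
have := mxrank_sum_cap u A.
have u0 : u != 0 by apply: contraNneq uA => ->; exact: sub0mx.
have -> : (u :&: A)%MS = 0.
  apply/eqP; rewrite -mxrank_eq0 -leqn0 leqNgt; apply: contra uA => r1.
  have : (u <= u :&: A)%MS.
    rewrite -(geq_leqif (mxrank_leqif_sup (capmxSl u A))) rank_rV u0 //.
  by move=> /submx_trans; apply; exact: capmxSr.
by rewrite mxrank0 addn0 rank_rV u0 addnC.
Qed.

(** * Span and corank of the rows selected over all rounds *)

Section RowSample.
Variables (R : realType) (N s T : nat) (U : 'M[R]_(N, s)).
Implicit Types (S : {set 'I_T * 'I_N}).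

Definition row_span S : 'M[R]_s := (\sum_(k in S) <<row k.2 U>>)%MS.

Definition corank S : R := s%:R - (\rank (row_span S))%:R.

Lemma row_span_setU1 k S :
  (row_span (k |: S) :=: (row k.2 U + row_span S)%MS)%MS.
Proof.
rewrite /row_span; have [kS|kS] := boolP (k \in S); last first.
  by rewrite finset.big_setU1 //=; apply: adds_eqmx => //; exact: genmxE.
have -> : k |: S = S by apply/finset.setUidPr; rewrite finset.sub1set.
apply/eqmx_sym/addsmx_idPr; apply: (sumsmx_sup k) => //.
by rewrite genmxE.
Qed.

Lemma corank_setU1 k S :
  corank S - corank (k |: S) = (~~ (row k.2 U <= row_span S)%MS)%:R.
Proof. by rewrite /corank row_span_setU1 rank_adds_row natrD; ring. Qed.

(** Every row has one copy per round, and all [T] copies give the same term, hence the factor [T] in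
    front of [corank_le_leverage]. *)
Lemma corank_decay (Uorth : orthonormal_cols U) S :
  T%:R * corank S <= \sum_(k : 'I_T * 'I_N)
    (row k.2 U *m (row k.2 U)^T) 0 0 * (corank S - corank (k |: S)).
Proof.
under eq_bigr do rewrite corank_setU1.
rewrite -(pair_bigA _ (fun (_ : 'I_T) i => (row i U *m (row i U)^T) 0 0 *
  (~~ (row i U <= row_span S)%MS)%:R)) /=.
rewrite sumr_const card_ord -[leRHS]mulr_natl ler_wpM2l ?ler0n //.
exact: corank_le_leverage.
Qed.

End RowSample.

(** The quadratic form of [Ybar] is a sum of squares with positive weights on the selected rows. If
    it vanishes at [v], then [v] is orthogonal to all these rows, hence zero when they span. *)
Lemma posdef_Ybar (R : realType) (N s nu : nat) (P : 'M[R]_N) (U : 'M[R]_(N, s))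
    (p : 'I_N -> R) (g : 'I_nu -> 'I_N -> bool) :
  (forall i, 0 < P i i) -> (forall i, 0 < p i) -> (0 < nu)%N ->
  corank U [set k : 'I_nu * 'I_N | g k.1 k.2] = 0 ->
  posdefmx (Ybar P U p g).
Proof.
move=> P0 p0 nu0 cr0.
pose D t := diag_mx (\row_i (Num.sqrt (P i i) * ((g t i)%:R / Num.sqrt (p i)))).
have YE : Ybar P U p g = nu%:R^-1 *: \sum_(t < nu) ((D t *m U)^T *m (D t *m U)).
  congr (_ *: _); apply: eq_bigr => t _; rewrite trmx_mul.
  have -> : D t = sketch_mx p (g t) *m sqrt_diag P.
    rewrite mulmx_diag; congr diag_mx; apply/rowP => i; rewrite !mxE; ring.
  by rewrite trmx_mul /sqrt_diag /sketch_mx !tr_diag_mx !mulmxA.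
split.
  rewrite YE linearZ /= linear_sum; congr (_ *: _); apply: eq_bigr => t _.
  by rewrite /= trmx_mul trmxK.
move=> v v0.
have vYv : (v^T *m Ybar P U p g *m v) 0 0 =
    nu%:R^-1 * \sum_(t < nu)
      ((v^T *m (D t *m U)^T) *m (v^T *m (D t *m U)^T)^T) 0 0.
  rewrite YE -scalemxAr -scalemxAl mxE mulmx_sumr mulmx_suml summxE.
  congr (_ * _); apply: eq_bigr => t _; move: (D t *m U) => M.
  by rewrite trmx_mul !trmxK !mulmxA.
rewrite vYv mulr_gt0 ?invr_gt0 ?ltr0n // lt0r sumr_ge0 ?andbT; last first.
  by move=> t _; exact: gram_ge0.
apply: contraNneq v0 => /eqP; rewrite psumr_eq0; last first.
  by move=> t _; exact: gram_ge0.
move=> /allP vD0.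
have Uv0 t i : g t i -> row i U *m v = 0.
  move=> gti; have := vD0 t (mem_index_enum _).
  rewrite [X in X == 0]mxE psumr_eq0; last first.
    by move=> j _; rewrite [_^T j 0]mxE -expr2 sqr_ge0.
  move=> /allP/(_ i (mem_index_enum _)).
  rewrite [_^T i 0]mxE -expr2 sqrf_eq0 -trmx_mul mxE -mulmxA mul_diag_mx mxE.
  rewrite mxE gti /= !mulf_eq0 invr_eq0 !sqrtr_eq0 !leNgt P0 p0 oner_eq0 /=.
  rewrite -[_ == 0 :> R]/((U *m v) i 0 == 0) => /eqP Uvi.
  by apply/matrixP => a b; rewrite !ord1 -row_mul mxE Uvi mxE.
set A := row_span U [set k : 'I_nu * 'I_N | g k.1 k.2].
have Av : A *m v = 0.
  have : (A <= kermx v)%MS.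
    apply/sumsmx_subP => -[t i]; rewrite inE => /= gti.
    rewrite genmxE; apply/sub_kermxP.
    exact: Uv0 gti.
  by move/sub_kermxP.
have rA : row_full A.
  by move/eqP: cr0; rewrite /corank -/A subr_eq0 eqr_nat eq_sym.
have /row_fullP[B BA] := rA.
by rewrite -[v]mul1mx -BA -mulmxA Av mulmx0.
Qed.

(** * Law of the random set of selected indices *)

Section SelectedSet.
Variables (R : realType) (I : finType) (d : measure_display).
Variables (Om : measurableType d) (Pr : probability Om R).
Variables (X : I -> {RV Pr >-> bool}) (p : I -> R).
Hypothesis p01 : forall i, 0 <= p i <= 1.
Hypothesis X_bern : forall i B,
  distribution Pr (X i) B = bernoulli_prob (p i) B.
Hypothesis X_indep : mutually_independent X.
Implicit Types (B : {set I}) (Q : set {set I}).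

Definition selected (w : Om) : {set I} := [set i | X i w].

Lemma selected_preimage1 B : selected @^-1` [set B] =
  \bigcap_(i in [set` [set: I]%SET]) (X i @^-1` [set (i \in B)]).
Proof.
apply/seteqP; split => w /= => [<- i _|XB]; first by rewrite /= inE.
by apply/setP => i; rewrite inE; apply: XB => /=; rewrite inE.
Qed.

Lemma measurable_selected Q : measurable (selected @^-1` Q).
Proof.
rewrite (_ : selected @^-1` Q = \bigcup_(B in Q) (selected @^-1` [set B])).
  apply: fin_bigcup_measurable => // B _; rewrite selected_preimage1.
  apply: fin_bigcap_measurable => // i _.
  by rewrite -[X in measurable X]setTI; exact: measurable_funP.
by apply/seteqP; split => [w Qw|w [B QB /= ->]] //=; exists (selected w).
Qed.

Lemma selected_pmf B : Pr (selected @^-1` [set B]) =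
  (\prod_i if i \in B then p i else 1 - p i)%:E.
Proof.
rewrite selected_preimage1 -prodEFin.
rewrite (@X_indep [set: I]%SET (fun i => [set i \in B])) //.
rewrite (eq_bigl xpredT) => [|i]; last by rewrite inE.
apply: eq_bigr => i _.
rewrite -[LHS]/(distribution Pr (X i) _) X_bern bernoulli_probE // !diracE.
by case: (i \in B); rewrite !in_set1 /= ?mule0 ?mule1 ?adde0 ?add0e.
Qed.

(** Markov's inequality: [f] dominates the indicator of [Q]. This passes from the probability space
    to the finite expectation [runion], where [1 - p i] is the probability of omitting [i]. *)
Lemma selected_markov Q (f : {set I} -> R) : (forall B, 0 <= f B) ->
  (forall B, Q B -> 1 <= f B) ->
  (Pr (selected @^-1` Q) <=
   (runion (fun i => 1 - p i) (enum I) f finset.set0)%:E)%E.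
Proof.
move=> f0 fQ.
have QE : Q = [set` enum (fun B => `[< Q B >])].
  by apply/seteqP; split => B /=; rewrite mem_enum => /asboolP.
have -> : selected @^-1` Q = \bigcup_(B in Q) (selected @^-1` [set B]).
  by apply/seteqP; split => [w Qw|w [B QB /= ->]] //=; exists (selected w).
rewrite measure_fin_bigcup //; last 3 first.
- by rewrite QE; exact: finite_seq.
- by move=> B C _ _ [w [/= <- <-]].
- by move=> B _; exact: measurable_selected.
rewrite QE -fsbig_seq ?enum_uniq // big_enum /=.
rewrite runion_pmf (eq_bigr _ (fun B _ => selected_pmf B)) sumEFin lee_fin.
rewrite [leRHS](bigID (fun B => `[< Q B >])) /= -[leLHS]addr0.
have pmf_ge0 B : 0 <= \prod_i if i \in B then p i else 1 - p i.
  apply: prodr_ge0 => i _; have /andP[p0 p1] := p01 i.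
  by case: ifP; rewrite ?subr_ge0.
have pmfE B : \prod_i (if i \in B then 1 - (1 - p i) else 1 - p i) =
    \prod_i if i \in B then p i else 1 - p i.
  by apply: eq_bigr => i _; rewrite subKr.
apply: lerD; last by apply: sumr_ge0 => B _; rewrite pmfE mulr_ge0.
by apply: ler_sum => B /asboolP QB; rewrite pmfE ler_peMl // fQ.
Qed.

End SelectedSet.

(** * From the expected corank to the probability bound *)

Lemma corank_ge1 (R : realType) (N s T : nat) (U : 'M[R]_(N, s))
    (S : {set 'I_T * 'I_N}) : corank U S != 0 -> 1 <= corank U S.
Proof.
rewrite /corank -natrB ?rank_leq_col // pnatr_eq0 -lt0n => lt0.
by rewrite ler1n.
Qed.

Lemma corank_ge0 (R : realType) (N s T : nat) (U : 'M[R]_(N, s))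
    (S : {set 'I_T * 'I_N}) : 0 <= corank U S.
Proof. by rewrite subr_ge0 ler_nat rank_leq_col. Qed.

Lemma corank_antitone (R : realType) (N s T : nat) (U : 'M[R]_(N, s)) k
    (S : {set 'I_T * 'I_N}) : corank U (k |: S) <= corank U S.
Proof. by rewrite -subr_ge0 corank_setU1 ler0n. Qed.

(** Orthonormality turns the leverage score into the squared row norm. Below the cap the claim is
    [1 + x <= expR x]; at the cap the left side is 0. *)
Lemma row_prob_exp (R : realType) (N s c : nat) (U : 'M[R]_(N, s)) i :
  orthonormal_cols U ->
  1 - row_prob c U i <=
  expR (- (row i U *m (row i U)^T) 0 0 * (c%:R / s%:R)).
Proof.
move=> Uorth; rewrite /row_prob /xi /leverage Uorth invmx1 mulmx1.
have [_|_] := leP 1 _; first by rewrite subrr expR_ge0.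
by apply: le_trans (expR_ge1Dx _); lra.
Qed.

Theorem corollary5p3 (R : realType) (N s : nat) (ltsN : (s < N)%N)
    (P : 'M[R]_N) (Pdiag : is_diag_mx P) (Ppos : forall i, 0 < P i i)
    (U : 'M[R]_(N, s)) (Uorth : orthonormal_cols U)
    (Uy : 'M[R]_(N, s)) (Sy Vy : 'M[R]_s)
    (svdPU : thin_svd (sqrt_diag P *m U) Uy Sy Vy)
    (beta : R) (beta_gt0 : 0 < beta) (beta_le1 : beta <= 1)
    (xi_beta : forall i : 'I_N, beta * xi Uy i <= xi U i)
    (c nu : nat) (c_gt0 : (0 < c)%N) (nu_gt0 : (0 < nu)%N)
    (eta_gt0 : forall i : 'I_N, 0 < row_prob c U i)
    (d : measure_display) (Om : measurableType d) (Pr : probability Om R)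
    (gamma : 'I_nu -> 'I_N -> {RV Pr >-> bool})
    (gamma_bern : forall t i (B : set bool),
      distribution Pr (gamma t i) B = bernoulli_prob (row_prob c U i) B)
    (gamma_indep : mutually_independent
      (fun ti : 'I_nu * 'I_N => gamma ti.1 ti.2)) :
  let Y (w : Om) : 'M[R]_s :=
    Ybar P U (row_prob c U) (fun t i => gamma t i w) in
  (Pr [set w | ~ posdefmx (Y w)] <=
    (2 * s%:R * expR (- (3 * nu%:R * c%:R * beta / (8 * s%:R))))%:E)%E /\
  (forall delta : R, 0 < delta < 1 ->
    8 * s%:R / (3 * nu%:R * beta) * ln (2 * s%:R / delta) <= c%:R ->
    ((1 - delta)%:E <= Pr [set w | posdefmx (Y w)])%E).
Proof.
move=> Y.
pose X (k : 'I_nu * 'I_N) := gamma k.1 k.2.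
pose p (k : 'I_nu * 'I_N) := row_prob c U k.2.
have p01 k : 0 <= p k <= 1 by rewrite ltW ?eta_gt0 //= ge_min lexx.
have X_bern k B : distribution Pr (X k) B = bernoulli_prob (p k) B.
  exact: gamma_bern.
(* Positive definiteness depends on the outcome only through the finite selected set, which yields
   measurability and allows [selected_markov] with [f] the corank. *)
pose PD (B : {set 'I_nu * 'I_N}) :=
  posdefmx (Ybar P U (row_prob c U) (fun t i => (t, i) \in B)).
have YE w : posdefmx (Y w) = PD (selected X w).
  by rewrite /Y /PD; congr (posdefmx (Ybar _ _ _ _));
    apply/funext => t; apply/funext => i; rewrite inE.
have meas : measurable [set w | posdefmx (Y w)].
  under eq_set do rewrite YE.
  exact: (measurable_selected X [set B | PD B]).
set bnd := 2 * s%:R * _.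
have bad : (Pr [set w | ~ posdefmx (Y w)] <= bnd%:E)%E.
  under eq_set do rewrite YE.
  apply: (@le_trans _ _ _ _ _ (selected_markov p01 X_bern gamma_indep
    (Q := [set B | ~ PD B]) (@corank_ge0 _ _ _ _ U) _)) => [B /= nPD|].
    apply: corank_ge1; apply: contra_notN nPD => /eqP cr0.
    apply: posdef_Ybar => //.
    by rewrite -[RHS]cr0; congr corank; apply/setP => -[t i]; rewrite inE.
  rewrite lee_fin.
  pose l (k : 'I_nu * 'I_N) := (row k.2 U *m (row k.2 U)^T) 0 0.
  (* Replace the Bernoulli draws by exponential clocks stopped at time [c / s]. *)
  apply: (@le_trans _ _ (runion (fun k => expR (- l k * (c%:R / s%:R)))
      (enum {: 'I_nu * 'I_N}) (corank U) finset.set0)).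
    apply: runion_antitone => [k|k|k|k S].
    - by have /andP[p0 p1] := p01 k; rewrite subr_ge0 p1 gerBl.
    - exact: row_prob_exp.
    - rewrite -[leRHS]expR0 ler_expR mulNr oppr_le0.
      by rewrite mulr_ge0 ?divr_ge0 // gram_ge0.
    - exact: corank_antitone.
  apply: le_trans (runion_decay _ _ (nu := nu%:R) _ _) _.
  - by rewrite divr_ge0.
  - by move=> k; exact: gram_ge0.
  - exact: corank_decay.
  apply: (@le_trans _ _ (expR (- nu%:R * (c%:R / s%:R)) * s%:R)).
    by rewrite ler_wpM2l ?expR_ge0 // gerBl ler0n.
  rewrite mulrC /bnd; have [->|s_gt0] := posnP s; first by rewrite mulr0 !mul0r.
  have s0 : 0 < s%:R :> R by rewrite ltr0n.
  apply: ler_pM; rewrite ?expR_ge0 //; first by lra.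
  (* The claimed exponent is [3 / 8 * beta] times the exponent obtained, and this factor is at most
     1. *)
  rewrite ler_expR mulNr lerN2 invfM.
  have : nu%:R * c%:R / s%:R * beta <= nu%:R * c%:R / s%:R.
    by rewrite ler_piMr // divr_ge0 // mulr_ge0.
  have : 0 <= nu%:R * c%:R / s%:R * beta.
    by rewrite mulr_ge0 ?(ltW beta_gt0) // divr_ge0 // mulr_ge0.
  by lra.
split=> // delta /andP[delta0 delta1] cdelta.
have bnd_delta : bnd <= delta.
  rewrite /bnd; have [->|s_gt0] := posnP s; first by rewrite mulr0 !mul0r ltW.
  have s0 : 0 < s%:R :> R by rewrite ltr0n.
  have nu0 : 0 < nu%:R :> R by rewrite ltr0n.
  have sd0 : 0 < 2 * s%:R / delta by rewrite divr_gt0 // mulr_gt0.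
  (* Taking logarithms turns the goal into the lower bound assumed on [c]. *)
  rewrite expRN ler_pdivrMr ?expR_gt0 // [leRHS]mulrC -ler_pdivrMr //.
  rewrite -[leLHS]lnK ?posrE // ler_expR.
  rewrite ler_pdivlMr ?mulr_gt0 //.
  move: cdelta; rewrite mulrAC ler_pdivrMr ?mulr_gt0 //; lra.
have -> : Pr [set w | posdefmx (Y w)] = (1 - Pr [set w | ~ posdefmx (Y w)])%E.
  rewrite -probability_setC; last first.
    rewrite (_ : [set w | ~ _] = ~` [set w | posdefmx (Y w)]) //.
    exact: measurableC.
  by congr (Pr _); rewrite -[LHS]setCK.
by rewrite EFinB leeB // (le_trans bad) // lee_fin.
Qed.
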